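(* Let $0<p\le 1$ and let $K\subseteq\mathbb{R}^n$. (a) If $K$ is a $p$-convex set, then $\mathrm{int}\,K$ is a $p$-convex set. (b) If $K$ is a $p$-convex set and $\mathrm{int}\,K\neq\emptyset$, then $\overline{\mathrm{int}\,K}=\overline{K}$. (c) If $K$ is a $p$-convex set and $\mathrm{int}\,K\neq\emptyset$, then $\mathrm{int}\,K=\mathrm{int}\,\overline{K}$.
   Context: For $0<p\le 1$, a set $K\subseteq\mathbb{R}^n$ is called $p$-convex if $\lambda x+\mu y\in K$ for every $x,y\in K$ and all $\lambda,\mu\ge 0$ with $\lambda^p+\mu^p=1$. $\mathrm{int}\,K$ and $\overline{K}$ denote the topological interior and closure of $K$ in $\mathbb{R}^n$. *)

(* Defs.v *)
From HB Require Import structures.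
From mathcomp Require Export all_boot all_order all_algebra.
From mathcomp Require Export all_classical all_reals all_analysis.

Set Implicit Arguments.
Unset Strict Implicit.
Unset Printing Implicit Defensive.

Import Order.TTheory GRing.Theory Num.Theory.
Import numFieldNormedType.Exports.

Local Open Scope classical_set_scope.
Local Open Scope ring_scope.

(* Intended for 0 < p <= 1; since then 0 `^ p = 0, the endpoints
   (lambda, mu) = (1, 0) and (0, 1) are admissible. *)
Definition pconvex (R : realType) (p : R) (n : nat) (K : set 'rV[R]_n) : Prop :=
  forall x y : 'rV[R]_n, K x -> K y ->
  forall lambda mu : R, 0 <= lambda -> 0 <= mu ->
    lambda `^ p + mu `^ p = 1 ->
    K (lambda *: x + mu *: y).

(* Main.v *)
(** The heart of the matter is the absorption property: if [x] is interior to
    [K], [y] lies in the closure of [K] and [lambda > 0], then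
    [lambda x + mu y] is interior to [K]. Indeed for [y'] in [K] close to [y]
    one can write [lambda x + mu y = lambda x' + mu y'] with [x'] still interior,
    and [lambda (int K) + mu y'] is an open subset of [K].
    Part (a) is the case [y] in [K]. Letting [lambda] tend to [0+], so that
    [mu] tends to [1], gives (b). For (c), a point [z] of [int (closure K)] is
    [lambda x + mu y] with [y = (z - lambda x) / mu], which tends to [z] and
    so belongs to [closure K] for small [lambda]. *)
Require Import Defs.
From mathcomp Require Import all_boot all_order all_algebra.
From mathcomp Require Import all_classical all_reals all_analysis.
Import Order.TTheory GRing.Theory Num.Theory.
Import numFieldNormedType.Exports.
Local Open Scope classical_set_scope.
Local Open Scope ring_scope.

Lemma continuous_scale_add {R : numFieldType} {V : normedModType R} (a : R)
    (b : V) : continuous (fun v : V => a *: v + b).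
Proof.
move=> v; apply: cvgD; last exact: cvg_cst.
by apply: cvgZ; [exact: cvg_cst | exact: cvg_id].
Qed.

Section weights_cvg.
Context {R : numFieldType} {V : normedModType R} {T : Type} {F : set_system T}.
Context {FF : Filter F}.
Context {l m : T -> R} (x z : V).
Hypotheses (l_cvg0 : l t @[t --> F] --> (0 : R)) (m_cvg1 : m t @[t --> F] --> (1 : R)).

Lemma cvg_weighted_sum : l t *: x + m t *: z @[t --> F] --> z.
Proof.
rewrite -[X in _ --> X]add0r -[X in _ --> X + _](scale0r x).
rewrite -[X in _ --> _ + X]scale1r.
by apply: cvgD; apply: cvgZ => //; exact: cvg_cst.
Qed.

Lemma cvg_weighted_sum_inv : (m t)^-1 *: (z - l t *: x) @[t --> F] --> z.
Proof.
rewrite -[X in _ --> X]subr0 -[X in _ --> _ - X](scale0r x).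
rewrite -[X in _ --> X]scale1r -[X in _ --> X *: _]invr1.
apply: cvgZ; first by apply: cvgV => //; exact: oner_neq0.
apply: cvgB; first exact: cvg_cst.
by apply: cvgZ => //; exact: cvg_cst.
Qed.

End weights_cvg.

Lemma pconvex_interior_closure {R : realType} {p : R} {n : nat}
    {K : set 'rV[R]_n} {x y : 'rV[R]_n} {lambda mu : R} :
  pconvex p K -> interior K x -> closure K y -> 0 < lambda -> 0 <= mu ->
  lambda `^ p + mu `^ p = 1 -> interior K (lambda *: x + mu *: y).
Proof.
move=> Kconv Kx Ky lambda0 mu0 lambda_mu.
have lambdaN0 : lambda != 0 by rewrite gt_eqF.
set z := lambda *: x + mu *: y.
pose c := lambda^-1 * mu.
(* [f w] is the solution [u] of [lambda *: u + mu *: w = z]. It is continuous in [w] and sends [y]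
   to [x], so it stays interior to [K] for [w] near [y]. *)
pose f (w : 'rV[R]_n) := (- c) *: w + lambda^-1 *: z.
have fyx : f y = x.
  rewrite /f /z scalerDr !scalerA mulVf// scale1r scaleNr addrCA.
  by rewrite /c addNr addr0.
have fy : nbhs (f y) (interior K).
  by rewrite fyx; apply: open_nbhs_nbhs; split => //; exact: open_interior.
have [y' [Ky' Kfy']] := Ky _ (continuous_scale_add _ _ _ _ fy).
(* Now [y'] is fixed and the target varies: [g v] solves [lambda *: u + mu *: y' = v], and [g z] is
   [f y']. *)
pose g (v : 'rV[R]_n) := lambda^-1 *: v + (- c) *: y'.
have gz : nbhs (g z) K by rewrite /g addrC.
apply: (@filterS _ (nbhs z) _ _ _ _ (continuous_scale_add _ _ _ _ gz)) => v Kgv.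
have -> : v = lambda *: g v + mu *: y'.
  by rewrite /g scalerDr !scalerA mulrN mulrA divff// !mul1r scale1r scaleNr subrK.
by apply: Kconv => //; exact: ltW.
Qed.

Lemma powR_inv_1sub_cvg1 (R : realType) (p : R) :
  (1 - t) `^ p^-1 @[t --> 0^'+] --> (1 : R).
Proof.
(* Continuity in the base comes from derivability at positive bases. *)
have cont1 : {for (1 : R), continuous (@powR R ^~ p^-1)}.
  apply: differentiable_continuous; apply/derivable1_diffP.
  by apply: derivable_powR; rewrite in_itv/= ltr01.
have sub_cvg1 : (1 - t : R) @[t --> 0^'+] --> (1 : R).
  rewrite -[X in _ --> X]subr0; apply: cvg_at_right_filter.
  by apply: cvgB; [exact: cvg_cst | exact: cvg_id].
by have := cvg_comp _ _ sub_cvg1 cont1; rewrite powR1.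
Qed.

Lemma powR_invK (R : realType) (p t : R) : p != 0 -> 0 <= t ->
  (t `^ p^-1) `^ p = t.
Proof. by move=> p0 t0; rewrite -powRrM mulVf// powRr1. Qed.

Theorem theorem4p4 (R : realType) (n : nat) (p : R) (hp0 : 0 < p) (hp1 : p <= 1)
    (K : set 'rV[R]_n) :
  [/\ pconvex p K -> pconvex p (interior K),
      pconvex p K -> interior K !=set0 -> closure (interior K) = closure K
    & pconvex p K -> interior K !=set0 -> interior K = interior (closure K)].
Proof.
have pN0 : p != 0 by rewrite gt_eqF.
(* The curve of admissible weights, parametrized by [t], the [p]-th power of the first weight. *)
pose l (t : R) := t `^ p^-1; pose m (t : R) := (1 - t) `^ p^-1.
have lm_sum t : 0 < t -> t < 1 -> l t `^ p + m t `^ p = 1.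
  by move=> t0 t1; rewrite !powR_invK ?subr_ge0 ?ltW// addrC subrK.
have l_cvg0 : l t @[t --> 0^'+] --> 0 by apply: powR_cvg0; rewrite invr_gt0.
have m_cvg1 : m t @[t --> (0 : R)^'+] --> (1 : R) by exact: powR_inv_1sub_cvg1.
split.
- move=> Kconv x y Kx Ky lambda mu; rewrite le_eqVlt => /orP[/eqP<-|lambda0] mu0.
    (* When the weight of [x] vanishes, that of [y] is positive, so [x] and [y] swap roles. *)
    rewrite powR0// add0r => mu1; rewrite addrC.
    apply: (pconvex_interior_closure Kconv Ky) => //.
    + by apply: subset_closure; exact: interior_subset.
    + rewrite lt_neqAle mu0 andbT; apply/eqP => mu_eq0.
      by move: mu1; rewrite -mu_eq0 powR0// => /esym/eqP; rewrite oner_eq0.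
    + by rewrite powR0// addr0.
  apply: (pconvex_interior_closure Kconv Kx) => //.
  by apply: subset_closure; exact: interior_subset.
- move=> Kconv [x Kx]; apply/seteqP; split.
    by apply: closureS; exact: interior_subset.
  move=> y Ky B By.
  have lmy : l t *: x + m t *: y @[t --> 0^'+] --> y by exact: cvg_weighted_sum.
  have Bt : \forall t \near (0 : R)^'+, B (l t *: x + m t *: y) by exact: lmy.
  near (0 : R)^'+ => t.
  have t0 : 0 < t by near: t; exact: nbhs_right_gt.
  have t1 : t < 1 by near: t; exact: nbhs_right_lt.
  exists (l t *: x + m t *: y); split; last by near: t.
  by apply: (pconvex_interior_closure Kconv Kx) => //;
    rewrite ?powR_ge0 ?powR_gt0// lm_sum.
- move=> Kconv [x Kx]; apply/seteqP; split.
    by apply: interiorS; exact: subset_closure.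
  move=> z cKz.
  pose w (t : R) := (m t)^-1 *: (z - l t *: x).
  have wz : w t @[t --> 0^'+] --> z by exact: cvg_weighted_sum_inv.
  (* By unfolding, [cKz] says that [closure K] is a neighbourhood of [z]. *)
  have Kw : \forall t \near (0 : R)^'+, closure K (w t) := wz _ cKz.
  near (0 : R)^'+ => t.
  have t0 : 0 < t by near: t; exact: nbhs_right_gt.
  have t1 : t < 1 by near: t; exact: nbhs_right_lt.
  have mN0 : m t != 0 by rewrite gt_eqF// powR_gt0// subr_gt0.
  have -> : z = l t *: x + m t *: w t.
    by rewrite /w scalerA divff// scale1r addrC subrK.
  apply: (pconvex_interior_closure Kconv Kx);
    rewrite ?powR_ge0 ?powR_gt0 ?lm_sum//.
  by near: t.
Unshelve. all: by end_near. Qed.
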